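(* Let $d\ge 2$ and let $C\subset E^d$ be a convex compact body with $C\subset B$. Let $U(m)\subset S$, $m\to\infty$, be an efficient covering of the hypersphere $S$ with constant $\Theta$. Let $P^m=P^+(C,2U(m))$, $m\to\infty$, be the sequence of polytopes generated by the non-adaptive polyhedral approximation method based on the projection operation and on the efficient coverings $U(m)$. Then for any $\lambda>0$ there exists $m(\lambda)$ such that for all $m\ge m(\lambda)$ $$\delta(C,P^m)\le \frac{(1+\lambda)A}{m^{2/(d-1)}},\qquad A=4\,\Theta^{2/(d-1)}.$$
   Context: $E^d$ is $d$-dimensional Euclidean space with scalar product $\langle\cdot,\cdot\rangle$, norm $\|\cdot\|$ and distance $\rho(\cdot,\cdot)$. $B$ is the closed unit ball centered at the origin and $S=\partial B$ is the unit sphere. A convex compact body is a compact convex set with non-empty interior. A set $U$ is an $\varepsilon$-net of a set $X$ if every point of $X$ is at distance at most $\varepsilon$ from $U$ (i.e. from some point of $U$). An efficient covering of the hypersphere with constant $\Theta$ is a sequence of sets $U(m)\subset S$, $m\to\infty$, where $U(m)$ consists of $m$ points and is an $\varepsilon(m)$-net of $S$ for some $\varepsilon(m)>0$ with $m\le \Theta/\varepsilon(m)^{d-1}$, the constant $\Theta$ being independent of $m$. For a number $t$, $tU=\{tu:u\in U\}$. The Hausdorff distance is $\delta(C_1,C_2)=\max\{\sup\{\rho(x,C_2):x\in C_1\},\ \sup\{\rho(x,C_1):x\in C_2\}\}$, where $\rho(x,A)$ is the distance from a point $x$ to a set $A$; the value $+\infty$ is allowed, so an upper bound includes the assertion that the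 distance is finite. For $p\notin C$, $\mathrm{proj}(p,C)$ is the unique point of $C$ nearest to $p$, and $$F(p)=\frac{p-\mathrm{proj}(p,C)}{\|p-\mathrm{proj}(p,C)\|}\in S.$$ For $u\in S$, the support function is $g(u,C)=\max\{\langle u,x\rangle : x\in C\}$ and the support half-space is $L(u,C)=\{x\in E^d:\langle u,x\rangle\le g(u,C)\}$. For $U\subset E^d\setminus C$, $$P^+(C,U)=\bigcap\{L(u,C): u\in F(U)\}.$$ *)

(* Defs.v *)
From mathcomp Require Export all_boot all_order all_algebra.
From mathcomp Require Export all_classical all_reals all_analysis.

Set Implicit Arguments.
Unset Strict Implicit.
Unset Printing Implicit Defensive.

Import Order.TTheory GRing.Theory Num.Theory.
Import numFieldNormedType.Exports.

Local Open Scope classical_set_scope.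
Local Open Scope ring_scope.

(* E^d is 'rV[R]_d. The norm that the library puts on 'rV[R]_d is the sup
   norm, so the Euclidean norm and distance are defined here; the topology
   (hence [compact] and [interior]) is the same for both norms. *)

Section EuclideanSpace.
Context {R : realType} {d : nat}.
Implicit Types (x y p u : 'rV[R]_d) (C U A X : set 'rV[R]_d).

Definition dot x y : R := \sum_(i < d) x ord0 i * y ord0 i.

Definition enorm x : R := Num.sqrt (dot x x).

Definition dist x y : R := enorm (x - y).

Definition unit_ball : set 'rV[R]_d := [set x | enorm x <= 1].

Definition unit_sphere : set 'rV[R]_d := [set x | enorm x = 1].

Definition convex_compact_body C : Prop :=
  [/\ convex_set C, compact C & interior C !=set0].

Definition eps_net (eps : R) U X : Prop :=
  forall x, X x -> exists2 u, U u & dist x u <= eps.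

Definition dist_to_set x A : \bar R := ereal_inf [set (dist x a)%:E | a in A].

Definition hausdorff_dist (C1 C2 : set 'rV[R]_d) : \bar R :=
  maxe (ereal_sup [set dist_to_set x C2 | x in C1])
       (ereal_sup [set dist_to_set x C1 | x in C2]).

(* [get] picks a point with the given property; for C nonempty, closed and
   convex there is exactly one nearest point. *)
Definition proj p C : 'rV[R]_d :=
  [get y | C y /\ forall z, C z -> dist p y <= dist p z].

Definition proj_dir C p : 'rV[R]_d :=
  (enorm (p - proj p C))^-1 *: (p - proj p C).

(* The supremum is a maximum when C is compact and nonempty. *)
Definition support_fun u C : R := sup [set dot u x | x in C].

Definition support_halfspace u C : set 'rV[R]_d :=
  [set x | dot u x <= support_fun u C].

Definition Pplus C U : set 'rV[R]_d :=
  \bigcap_(u in proj_dir C @` U) support_halfspace u C.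

Definition scale_set (t : R) U : set 'rV[R]_d := [set t *: u | u in U].

(* The cardinality m tends to infinity along the set M of those m for which
   U m is given; values of U outside M are irrelevant. *)
Definition efficient_covering (Theta : R) (M : set nat)
    (U : nat -> set 'rV[R]_d) : Prop :=
  infinite_set M /\
  forall m : nat, M m ->
    [/\ U m `<=` unit_sphere,
        (U m #= `I_m)%card &
        exists eps : R, [/\ 0 < eps,
          eps_net eps (U m) unit_sphere &
          m%:R <= Theta / eps ^+ (d - 1)]].

End EuclideanSpace.

(* Main.v *)
(* Let x be a point of the polytope outside C, y its projection, h = |x - y| and
   v the direction of x - y.  The ray from y in direction v leaves the sphere 2S
   at p = y + a v; some q in 2U lies within 2 eps of p; write q = z + b w with z
   the projection of q and w = F(q).  As C lies in B, a, b >= 1, so the obtuse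
   angles of C at y and z give |y - z|^2 + |v - w|^2 <= |p - q|^2 <= 4 eps^2.
   Since x lies in the support half-space with normal w,
     h <w, v> <= <w, z - y> <= <v - w, y - z> <= 2 eps^2,
   and <w, v> >= 1 - 2 eps^2 >= 1/2 once eps <= 1/2, so h <= 4 eps^2. *)

Require Import Defs.
From mathcomp Require Import all_boot all_order all_algebra.
From mathcomp Require Import all_classical all_reals all_analysis.
From mathcomp Require Import ring lra.

Import Order.TTheory GRing.Theory Num.Theory.
Import numFieldNormedType.Exports.

Local Open Scope classical_set_scope.
Local Open Scope ring_scope.

Set Implicit Arguments.
Unset Strict Implicit.
Unset Printing Implicit Defensive.

(** * Scalar product and Euclidean norm on row vectors *)

Section Dot.
Context {R : realType} {d : nat}.
Implicit Types (x y z : 'rV[R]_d) (a : R).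

Lemma dotC x y : dot x y = dot y x.
Proof. by apply: eq_bigr => i _; rewrite mulrC. Qed.

Lemma dotDl x y z : dot (x + y) z = dot x z + dot y z.
Proof. by rewrite -big_split; apply: eq_bigr => i _; rewrite mxE mulrDl. Qed.

Lemma dotZl a x z : dot (a *: x) z = a * dot x z.
Proof. by rewrite mulr_sumr; apply: eq_bigr => i _; rewrite mxE mulrA. Qed.

Lemma dotNl x z : dot (- x) z = - dot x z.
Proof. by rewrite -scaleN1r dotZl mulN1r. Qed.

Lemma dotDr x y z : dot z (x + y) = dot z x + dot z y.
Proof. by rewrite dotC dotDl !(dotC z). Qed.

Lemma dotZr a x z : dot z (a *: x) = a * dot z x.
Proof. by rewrite dotC dotZl (dotC z). Qed.

Lemma dotNr x z : dot z (- x) = - dot z x.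
Proof. by rewrite dotC dotNl (dotC z). Qed.

Definition dotE := (dotDl, dotDr, dotNl, dotNr, dotZl, dotZr).

Lemma sqr_dotB a x y :
  dot (x - a *: y) (x - a *: y) =
    dot x x - 2 * (a * dot x y) + a ^+ 2 * dot y y.
Proof. by rewrite !dotE (dotC y x); ring. Qed.

Lemma dot_ge0 x : 0 <= dot x x.
Proof. by apply: sumr_ge0 => i _; exact: sqr_ge0. Qed.

Lemma dot_eq0 x : dot x x = 0 -> x = 0.
Proof.
move/eqP; rewrite psumr_eq0 => [/allP x0|i _]; last exact: sqr_ge0.
apply/rowP => i; apply/eqP; rewrite mxE -sqrf_eq0 expr2.
exact: x0 (mem_index_enum i).
Qed.

Lemma enorm_ge0 x : 0 <= enorm x.
Proof. exact: sqrtr_ge0. Qed.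

Lemma sqr_enorm x : enorm x ^+ 2 = dot x x.
Proof. by rewrite sqr_sqrtr ?dot_ge0. Qed.

Lemma dot_unit x : enorm x = 1 -> dot x x = 1.
Proof. by rewrite -sqr_enorm => ->; rewrite expr1n. Qed.

Lemma le_enorm x a : 0 <= a -> (enorm x <= a) = (dot x x <= a ^+ 2).
Proof. by move=> a0; rewrite -sqr_enorm ler_pXn2r ?nnegrE ?enorm_ge0. Qed.

(** Expanding |x - y|^2 >= 0 suffices: the Cauchy-Schwarz inequality for vectors of the unit
    ball. *)
Lemma dot_le1 x y : dot x x <= 1 -> dot y y <= 1 -> dot x y <= 1.
Proof. by move=> x1 y1; have := dot_ge0 (x - y); rewrite !dotE (dotC y x); lra. Qed.

Lemma enorm_dir x : x != 0 ->
  0 < enorm x /\ dot ((enorm x)^-1 *: x) ((enorm x)^-1 *: x) = 1.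
Proof.
move=> x0; have n0 : 0 < enorm x.
  rewrite lt_neqAle enorm_ge0 andbT eq_sym; apply: contra x0 => /eqP n0.
  by apply/eqP/dot_eq0; rewrite -sqr_enorm n0 expr0n.
split=> //; rewrite !dotE -sqr_enorm; field; exact: lt0r_neq0.
Qed.

(** Used to obtain nearest points by compactness. The topology is that of the sup norm, so
    continuity is built up from the coordinates, summand by summand. *)
Lemma dist_continuous x : continuous (dist x).
Proof.
have sq_cont (i : 'I_d) :
    continuous (fun y : 'rV[R]_d => (x - y) ord0 i * (x - y) ord0 i).
  have -> : (fun y : 'rV[R]_d => (x - y) ord0 i * (x - y) ord0 i) =
            (fun y => (x ord0 i - y ord0 i) * (x ord0 i - y ord0 i)).
    by apply/funext => y; rewrite !mxE.
  move=> y; have cy : x ord0 i - z ord0 i @[z --> y] --> x ord0 i - y ord0 i.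
    apply: (@cvgB _ _ _ (nbhs y) _ (cst (x ord0 i)) (fun z : 'rV[R]_d => z ord0 i)).
      exact: cvg_cst.
    exact: coord_continuous.
  apply: (@cvgM _ _ (nbhs y) _ _ _ _ _ cy cy).
have sum_cont (s : seq 'I_d) : continuous
    (fun y : 'rV[R]_d => \sum_(i <- s) (x - y) ord0 i * (x - y) ord0 i).
  elim: s => [|i s IHs].
    rewrite (_ : (fun _ => _) = cst 0); first exact: cst_continuous.
    by apply/funext => y; rewrite big_nil.
  rewrite (_ : (fun _ => _) = (fun y : 'rV[R]_d =>
      (x - y) ord0 i * (x - y) ord0 i +
      \sum_(i <- s) (x - y) ord0 i * (x - y) ord0 i)); last first.
    by apply/funext => y; rewrite big_cons.
  by move=> y; apply: (@cvgD _ _ _ (nbhs y) _ _ _ _ _ (sq_cont i y) (IHs y)).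
move=> y; apply: (@continuous_comp _ _ _ (fun z => dot (x - z) (x - z)) Num.sqrt).
  exact: sum_cont.
exact: sqrt_continuous.
Qed.

End Dot.

(** * Nearest points of a convex body and the outward normals they give *)

Section Projection.
Context {R : realType} {d : nat}.
Variable C : set 'rV[R]_d.
Hypothesis bodyC : convex_compact_body C.
Implicit Types x y z p : 'rV[R]_d.

Lemma body_nonempty : C !=set0.
Proof. by case: bodyC => _ _ [x /interior_subset Cx]; exists x. Qed.

Lemma body_segment y z (t : R) : 0 <= t <= 1 -> C y -> C z ->
  C (y + t *: (z - y)).
Proof.
move=> /andP[t0 t1] Cy Cz; case: bodyC => cC _ _.
have := cC z y (Itv01 t0 t1) (mem_set Cz) (mem_set Cy).
move/set_mem; congr C; rewrite /conv /= /unstable.onem scalerBr scalerBl scale1r.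
by rewrite addrCA (addrC y).
Qed.

(** A continuous function attains its minimum on a nonempty compact set, so [get] returns a genuine
    nearest point and not its default value. *)
Lemma proj_spec p : C (Defs.proj p C) /\ forall z, C z -> dist p (Defs.proj p C) <= dist p z.
Proof.
apply: (@getPex _ (fun y => C y /\ forall z, C z -> dist p y <= dist p z)).
have [_ kC _] := bodyC.
have [] := EVT_min_rV body_nonempty kC (f := dist p).
  exact/continuous_subspaceT/dist_continuous.
by move=> c /set_mem Cc minc; exists c; split=> // z Cz; exact/minc/mem_set.
Qed.

(** If the product s were positive, a small move from y towards z, which stays in C by convexity,
    would come closer to p. *)
Lemma proj_variational p z : C z -> dot (p - Defs.proj p C) (z - Defs.proj p C) <= 0.
Proof.
have [] := proj_spec p; set y := Defs.proj p C => Cy miny Cz.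
rewrite leNgt; apply/negP; set s := dot _ _ => s0.
set N := dot (z - y) (z - y); have N0 : 0 <= N by exact: dot_ge0.
have Ns : 0 < N + s by lra.
(* A step t along z - y changes the squared distance by t (t N - 2 s). With t = s / (N + s) one has
   t N = s - t s < 2 s, and t <= 1. *)
have t01 : 0 <= s / (N + s) <= 1.
  by rewrite divr_ge0 ?ler_pdivrMr ?mul1r; lra.
have /miny := body_segment t01 Cy Cz.
rewrite /dist le_enorm ?enorm_ge0// sqr_enorm opprD addrA.
rewrite sqr_dotB -/s -/N.
set t := s / (N + s) in t01 *.
have ts : t * (N + s) = s by rewrite /t divfK// lt0r_neq0.
have t0 : 0 < t by rewrite divr_gt0.
suff : t * (t * N - 2 * s) < 0 by lra.
by rewrite pmulr_rlt0//; nra.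
Qed.

Lemma proj_dirP p : ~ C p ->
  [/\ 0 < enorm (p - Defs.proj p C), dot (proj_dir C p) (proj_dir C p) = 1,
      p = Defs.proj p C + enorm (p - Defs.proj p C) *: proj_dir C p &
      forall z, C z -> dot (proj_dir C p) (z - Defs.proj p C) <= 0].
Proof.
move=> Cp; have [Cy _] := proj_spec p.
have /enorm_dir[n0 n1] : p - Defs.proj p C != 0.
  by apply: contra_notN Cp; rewrite subr_eq0 => /eqP ->.
split=> // [|z Cz].
  by rewrite scalerA divff ?lt0r_neq0// scale1r addrC subrK.
by rewrite dotZl pmulr_rle0 ?invr_gt0// proj_variational.
Qed.

(** The direction is an outward normal of C at the projection, so no point of C exceeds the
    projection in that direction. *)
Lemma support_fun_dir p : ~ C p ->
  support_fun (proj_dir C p) C <= dot (proj_dir C p) (Defs.proj p C).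
Proof.
move=> /proj_dirP[_ _ _ maxp]; apply: ge_sup; first exact/image_nonempty/body_nonempty.
by move=> _ [z Cz <-]; have := maxp z Cz; rewrite !dotE subr_le0.
Qed.

Hypothesis subC : C `<=` unit_ball.

Lemma sub_Pplus (U : set 'rV[R]_d) : (forall u, U u -> ~ C u) -> C `<=` Pplus C U.
Proof.
move=> UC x Cx _ [u /UC Cu <-]; apply: ub_le_sup; last by exists x.
have [_ _ _ maxu] := proj_dirP Cu.
(* A supremum dominates its set only if the set is bounded above; the value at the projection is a
   bound. *)
exists (dot (proj_dir C u) (Defs.proj u C)) => _ [z Cz <-].
by have := maxu z Cz; rewrite !dotE subr_le0.
Qed.

Lemma unit_ball_dot x : C x -> dot x x <= 1.
Proof. by move=> /subC; rewrite /unit_ball /= le_enorm// expr1n. Qed.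

End Projection.

(** * Quadratic estimate of the depth of the polytope beyond C *)

Section Estimate.
Context {R : realType} {d : nat}.
Implicit Types u v w x y z D : 'rV[R]_d.

(** Triangle inequality in squared form: 4 <= (1 + a)^2. *)
Lemma sphere2_depth y v (a : R) : dot y y <= 1 -> dot v v = 1 -> 0 <= a ->
  dot (y + a *: v) (y + a *: v) = 4 -> 1 <= a.
Proof.
move=> y1 v1 a0; have yv : dot y v <= 1 by rewrite dot_le1 ?v1.
rewrite !dotE v1 (dotC v y) => q4.
by rewrite leNgt; apply/negP => a1; nra.
Qed.

Lemma ray_sphere2 y v : dot y y <= 1 -> dot v v = 1 ->
  exists2 a : R, 0 <= a & dot (y + a *: v) (y + a *: v) = 4.
Proof.
move=> y1 v1; set b := dot y v; set s := Num.sqrt (b ^+ 2 + (4 - dot y y)).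
have s2 : s ^+ 2 = b ^+ 2 + (4 - dot y y).
  by rewrite sqr_sqrtr//; have := sqr_ge0 b; lra.
(* The larger root of a^2 + 2 a b + |y|^2 - 4 = 0, nonnegative because |y| <= 1. *)
exists (s - b); last by rewrite !dotE v1 (dotC v y) -/b; nra.
have s0 : 0 <= s := sqrtr_ge0 _.
by rewrite leNgt; apply/negP => sb; nra.
Qed.

(** The scalar core of the estimate, with D = y - z, so that D + (a v - b w) = p - q. *)
Lemma depth_bound v w D (a b h e : R) :
  dot v v = 1 -> dot w w = 1 -> 1 <= a -> 1 <= b -> 0 <= h -> 0 <= e <= 1 / 2 ->
  0 <= dot v D -> dot w D <= 0 ->
  dot (D + (a *: v - b *: w)) (D + (a *: v - b *: w)) <= 4 * e ^+ 2 ->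
  h * dot w v <= - dot w D -> h <= 4 * e ^+ 2.
Proof.
move=> v1 w1 a1 b1 h0 /andP[e0 e1] vD wD.
have c1 : dot v w <= 1 by apply: dot_le1; rewrite ?v1 ?w1.
(* The sign of |D - (v - w)|^2 will give -2 <w, D> <= |D|^2 + |v - w|^2, as <v, D> >= 0. *)
have E0 := dot_ge0 D; have := dot_ge0 (D - (v - w)).
rewrite !dotE v1 w1 (dotC w v) (dotC D v) (dotC D w).
move: (dot v w) (dot v D) (dot w D) (dot D D) c1 vD wD E0 => c al be E c1 vD wD E0 H1 H2 H3.
(* The left side is (a - b)^2 + 2 a b (1 - c), and a b >= 1: lengthening v and w does not bring
   their ends closer. *)
have ab : a * a + b * b - 2 * (a * b * c) >= 2 - 2 * c.
  have : 0 <= (a * b - 1) * (1 - c) by apply: mulr_ge0; nra.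
  by have := sqr_ge0 (a - b); nra.
have aal : 0 <= a * al by apply: mulr_ge0 => //; lra.
have bbe : 0 <= b * (- be) by apply: mulr_ge0; lra.
have E4 : E + (2 - 2 * c) <= 4 * e ^+ 2 by nra.
have e2 : e ^+ 2 <= 1 / 4 by nra.
have : 0 <= h * (c - 1 / 2) by apply: mulr_ge0; lra.
nra.
Qed.

Variable C : set 'rV[R]_d.
Hypotheses (bodyC : convex_compact_body C) (subC : C `<=` unit_ball).

Lemma scale2_notin (U : set 'rV[R]_d) q :
  U `<=` unit_sphere -> scale_set 2 U q -> dot q q = 4 /\ ~ C q.
Proof.
move=> US [u /US/dot_unit u1 <-]; have q4 : dot (2 *: u) (2 *: u) = 4.
  by rewrite !dotE u1; ring.
by split=> // /(unit_ball_dot subC); rewrite q4; lra.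
Qed.

Lemma dist_Pplus_proj (U : set 'rV[R]_d) (e : R) x :
  U `<=` unit_sphere -> eps_net e U unit_sphere -> 0 <= e <= 1 / 2 ->
  Pplus C (scale_set 2 U) x -> dist x (Defs.proj x C) <= 4 * e ^+ 2.
Proof.
move=> US net e01 Px; have [e0 _] := andP e01.
have [Cy _] := proj_spec bodyC x; rewrite /dist.
(* For x in C, the variational inequality tested at x itself gives distance 0. *)
have [Cx|/(proj_dirP bodyC)] := pselect (C x).
  have := proj_variational bodyC x Cx; rewrite -sqr_enorm => n0.
  by have := enorm_ge0 (x - Defs.proj x C); nra.
set y := Defs.proj x C in Cy *; set h := enorm _; set v := proj_dir C x.
move=> [h0 v1 xE maxv].
have y1 := unit_ball_dot subC Cy.
have [a a0 p4] := ray_sphere2 y1 v1; have a1 := sphere2_depth y1 v1 a0 p4.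
set p := y + a *: v in p4.
(* The net lives on S, so p is halved first; doubling the net point found gives q within 2 e of
   p. *)
have Sp : unit_sphere (2^-1 *: p).
  have quarter : 2^-1 * (2^-1 * 4) = 1 :> R by lra.
  by rewrite /unit_sphere /= /enorm dotZl dotZr p4 quarter sqrtr1.
have [u Uu] := net _ Sp; rewrite /dist le_enorm// => pu.
set q := 2 *: u; have Uq : scale_set 2 U q by exists u.
have [q4 Cq] := scale2_notin US Uq.
have := proj_dirP bodyC Cq; have [Cz _] := proj_spec bodyC q.
have := Px _ (imageP (proj_dir C) Uq); rewrite /support_halfspace /=.
move=> /le_trans /(_ (support_fun_dir bodyC Cq)).
set z := Defs.proj q C in Cz *; set b := enorm _; set w := proj_dir C q.
move=> xw [b0 w1 qE maxw].
have b1 : 1 <= b.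
  by apply: (sphere2_depth (unit_ball_dot subC Cz) w1 (ltW b0)); rewrite -qE.
apply: (@depth_bound v w (y - z) a b h e) => //; first exact: ltW.
- by have := maxv z Cz; rewrite !dotE; lra.
- exact: maxw.
- have -> : y - z + (a *: v - b *: w) = 2 *: (2^-1 *: p - u).
    rewrite scalerBr (scalerA 2 2^-1 p) divff ?pnatr_eq0// scale1r -/q qE /p.
    by rewrite opprD addrACA.
  by rewrite dotZl dotZr; lra.
- by move: xw; rewrite xE !dotE; lra.
Qed.

(** C lies in the polytope, so the first supremum is handled by taking each point as its own
    neighbour; the second is bounded by distances to projections. *)
Lemma hausdorff_dist_Pplus (U : set 'rV[R]_d) (e : R) :
  U `<=` unit_sphere -> eps_net e U unit_sphere -> 0 <= e <= 1 / 2 ->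
  (hausdorff_dist C (Pplus C (scale_set 2 U)) <= (4 * e ^+ 2)%:E)%E.
Proof.
move=> US net e01; rewrite /hausdorff_dist ge_max; apply/andP; split;
  apply: ge_ereal_sup => _ [x xin <-]; apply: ge_ereal_inf.
  exists (dist x x)%:E.
    exists x => //; apply: (sub_Pplus bodyC) => // q Uq.
    by have [] := scale2_notin US Uq.
  rewrite lee_fin /dist subrr le_enorm; last by have := sqr_ge0 e; lra.
  by rewrite -(scale0r x) !dotE mul0r sqr_ge0.
exists (dist x (Defs.proj x C))%:E.
  by exists (Defs.proj x C) => //; have [] := proj_spec bodyC x.
by rewrite lee_fin; exact: dist_Pplus_proj net e01 xin.
Qed.

End Estimate.

(** * From the covering radius to the number of points *)

Lemma le_expn_powR (R : realType) (e t : R) (k : nat) :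
  (0 < k)%N -> 0 <= e -> e ^+ k <= t -> e ^+ 2 <= t `^ (2 / k%:R).
Proof.
move=> k0 e0 ekt; have k1 : k%:R != 0 :> R by rewrite pnatr_eq0 -lt0n.
have -> : e ^+ 2 = (e ^+ k) `^ (2 / k%:R).
  by rewrite -!powR_mulrn// -powRrM mulrCA divff// mulr1.
apply: ge0_ler_powR; rewrite ?nnegrE ?divr_ge0 ?exprn_ge0//.
by apply: le_trans ekt; exact: exprn_ge0.
Qed.

Theorem theorem3 (R : realType) (d : nat) (C : set 'rV[R]_d)
    (Theta : R) (M : set nat) (U : nat -> set 'rV[R]_d) :
  (2 <= d)%N ->
  convex_compact_body C ->
  C `<=` unit_ball ->
  efficient_covering Theta M U ->
  let P (m : nat) := Pplus C (scale_set 2 (U m)) in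
  let A := 4 * Theta `^ (2 / (d - 1)%:R) in
  forall lambda : R, 0 < lambda ->
  exists m0 : nat, forall m : nat, M m -> (m0 <= m)%N ->
    (hausdorff_dist C (P m) <=
       ((1 + lambda) * A / m%:R `^ (2 / (d - 1)%:R))%:E)%E.
Proof.
move=> d2 bodyC subC [_ covU] P A lambda lambda0.
have k0 : (0 < d - 1)%N by rewrite subn_gt0.
set k := (d - 1)%N in k0 A *.
(* For m beyond this bound, e^k <= Theta / m <= 2^-k, hence e <= 1/2. The absolute value is there
   because the sign of Theta is known only once some m is given; the successor below makes m
   positive. *)
pose m0 := Num.bound (`|Theta| * 2 ^+ k).
exists m0.+1 => m Mm m0m; have [US _ [e [e0 net me]]] := covU m Mm.
have mp : 0 < m%:R :> R by rewrite ltr0n (leq_trans _ m0m).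
have ek : 0 < e ^+ k by exact: exprn_gt0.
have mek : m%:R * e ^+ k <= Theta by rewrite -ler_pdivlMr.
have Theta0 : 0 < Theta by apply: lt_le_trans mek; exact: mulr_gt0.
have ekt : e ^+ k <= Theta / m%:R by rewrite ler_pdivlMr// mulrC.
have e01 : 0 <= e <= 1 / 2.
  rewrite ltW//= div1r -(@ler_pXn2r _ k)// ?nnegrE ?(ltW e0)// ?invr_ge0//.
  apply: le_trans ekt _; rewrite exprVn ler_pdivrMr// ler_pdivlMl ?exprn_gt0//.
  rewrite mulrC -{1}(gtr0_norm Theta0); apply/ltW/(lt_le_trans (archi_boundP _)).
    by rewrite mulr_ge0 ?exprn_ge0.
  by rewrite ler_nat ltnW.
apply: le_trans (hausdorff_dist_Pplus bodyC subC US net e01) _.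
rewrite lee_fin.
have := le_expn_powR k0 (ltW e0) ekt.
(* The inverse of m is written as a power with exponent -1, so that the exponents commute and (Theta
   / m)^(2/k) splits into a quotient of powers. *)
rewrite powRM ?invr_ge0 ?(ltW mp) ?(ltW Theta0)// -[m%:R^-1]powR_inv1 ?(ltW mp)//.
rewrite powRAC powR_inv1 ?powR_ge0// => e2.
apply: (@le_trans _ _ (A / m%:R `^ (2 / k%:R))); first by rewrite /A -mulrA ler_pM2l.
rewrite ler_pM2r ?invr_gt0 ?powR_gt0// ler_peMl ?lerDl ?(ltW lambda0)//.
by rewrite mulr_ge0// powR_ge0.
Qed.
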